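(* Let $(R,M)$ be a log-ring. The category of 2-typical Witt complexes over $(R,M)$ has an initial object (denoted $W_\bullet\Omega^*_{(R,M)}$ and called the 2-typical de Rham-Witt complex of $(R,M)$).
   Context: All rings are commutative and unital; graded rings are graded-commutative, i.e. $xy=(-1)^{|x||y|}yx$. For a ring $A$, $W_n(A)$ is the ring of 2-typical Witt vectors of length $n$ ($W_n(A)=0$ for $n\le 0$), with restriction $R$, Frobenius $F:W_n(A)\to W_{n-1}(A)$, Verschiebung $V:W_{n}(A)\to W_{n+1}(A)$, and Teichmüller map $[a]_n=(a,0,\dots,0)$. A pro-object is a sequence $\{X_n\}_{n\in\mathbb Z}$ with maps $R:X_n\to X_{n-1}$; a strict map is a family of maps commuting with $R$. A 2-typical Witt complex over $A$ consists of: (i) a graded-commutative pro-graded ring $\{E_n^*,R:E_n^*\to E_{n-1}^*\}_{n\in\mathbb Z}$ with $E_n^*=0$ for $n\le0$; (ii) a strict map of pro-rings $\lambda:W_\bullet(A)\to E^0_\bullet$; (iii) a strict map of pro-graded rings $F:E^*_\bullet\to E^*_{\bullet-1}$ with $\lambda F=F\lambda$; (iv) a strict map of pro-graded abelian groups $V:E^*_\bullet\to E^*_{\bullet+1}$ with $V(x)y=V(xF(y))$, $\lambda V=V\lambda$ and $FV=2$; (v) a strict map of pro-graded abelian groups $d:E^*_\bullet\to E^{*+1}_\bullet$ with $d(xy)=d(x)y+(-1)^{|x|}x\,d(y)$. Let $\iota$ be multiplication by $\frac{d\lambda[-1]_n}{\lambda[-1]_n}$. One requires $FdV=d+\iota$,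 $dd=d\iota=\iota d$, and $Fd\lambda([a]_n)=\lambda([a]_{n-1})\,d\lambda([a]_{n-1})$ for all $a\in A$. Morphisms are maps of pro-graded rings commuting with $\lambda,d,F,V$. A log-ring $(R,M)$ is a ring $R$ with a map of monoids $\alpha:M\to R$ (multiplication on $R$), called a pre-log structure. A derivation of a log-ring $(R,M)$ into an $R$-module $N$ is a derivation $D:R\to N$ with a monoid map $D\log:M\to N$ such that $\alpha(a)D\log(a)=D\alpha(a)$. The log-ring $(W_n(R),M)$ has structure map $a\mapsto[\alpha(a)]_n$. A 2-typical Witt complex over $(R,M)$ is a 2-typical Witt complex $E$ over $R$ with a monoid $M_E$, pre-log structures $\alpha_n:M_E\to E_n^0$, monoid maps $d\log:M_E\to E_n^1$ (compatible with $R$) such that $(d,d\log)$ is a derivation of $(E_n^0,M_E)$, and an extension of $\lambda$ to a strict map of pro-log-rings $(W_\bullet(R),M)\to(E_\bullet^0,M_E)$ (i.e. a compatible monoid map $M\to M_E$), such that (i) $R\circ\alpha_n=\alpha_{n-1}$; (ii) $d(d\log[a]_n)=0$ for $a\in M$; (iii) $F\,d\log[a]_n=d\log[a]_{n-1}$ for $a\in M$; here $d\log[a]_n\in E_n^1$ is $d\log$ of the image of $a$ in $M_E$. Morphisms are morphisms of Witt complexes with a compatible monoid map (compatible with the maps from $M$ and with the $\alpha_n$), commuting with $d\log$. *)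

(* Defs.v *)
From HB Require Import structures.
From mathcomp Require Import all_boot all_order all_algebra.
From mathcomp Require Import mpoly zify ring.

Set Implicit Arguments.
Unset Strict Implicit.
Unset Printing Implicit Defensive.

Import GRing.Theory Num.Theory.
Local Open Scope ring_scope.

(* 2-typical Witt vectors of length n over A are vectors in A^n. The ring     *)
(* operations and the Frobenius are given by the universal integral           *)
(* polynomials determined by the ghost components                             *)
(*     w_k(x) = \sum_(i <= k) 2 ^ i * x_i ^ (2 ^ (k - i)).                    *)
(* comPzRingType is used throughout because W_0(A), and A itself, may be the  *)
(* zero ring.                                                                 *)

Record witt (n : nat) (A : Type) := Witt { wcoord : {ffun 'I_n -> A} }.

Definition wfun n A (x : witt n A) : 'I_n -> A := wcoord x.
Coercion wfun : witt >-> Funclass.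

HB.instance Definition _ n A := [isNew for @wcoord n A].
HB.instance Definition _ n (A : choiceType) := [Choice of witt n A by <:].

Definition mkwitt n A (f : 'I_n -> A) : witt n A := Witt [ffun i => f i].

Definition ghost n (A : comPzRingType) (k : nat) (x : witt n A) : A :=
  \sum_(i < n | (i <= k)%N) x i ^+ (2 ^ (k - i)) *+ 2 ^ i.

Definition witt_map n A B (f : A -> B) (x : witt n A) : witt n B :=
  mkwitt (fun i => f (x i)).

Lemma mkwittE n A (f : 'I_n -> A) i : mkwitt f i = f i.
Proof. by rewrite /mkwitt /wfun /= ffunE. Qed.

Lemma wittP n A (x y : witt n A) : (forall i, x i = y i) -> x = y.
Proof.
case: x y => [x] [y] exy; congr Witt; apply/ffunP => i; exact: exy.
Qed.

Lemma ghost_map n (A B : comPzRingType) (f : {rmorphism A -> B}) k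
    (x : witt n A) :
  ghost k (witt_map f x) = f (ghost k x).
Proof.
rewrite /ghost rmorph_sum; apply: eq_bigr => i _.
by rewrite mkwittE rmorphMn rmorphXn.
Qed.

Section Evaluation.

(* mmap from the multinomials library wants a nontrivial target ring.         *)
Definition peval m (A : comPzRingType) (h : 'I_m -> A) (p : {mpoly int[m]}) : A :=
  \sum_(mm <- msupp p) (p@_mm)%:~R * \prod_(i < m) h i ^+ mm i.

Variables (m : nat) (A : comPzRingType) (h : 'I_m -> A).

Let nzA (nz : 1 != 0 :> A) : comNzRingType :=
  HB.pack (GRing.ComPzRing.sort A) (GRing.PzSemiRing_isNonZero.Build A nz).

Let trivA : 1 = 0 :> A -> forall x y : A, x = y.
Proof. by move=> e x y; rewrite -[x]mul1r -[y]mul1r e !mul0r. Qed.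

Fact peval_is_additive : zmod_morphism (peval h).
Proof.
have [/trivA e p q|nz p q] := eqVneq (1 : A) 0; first exact: e.
exact: (@rmorphB _ _ (mmap (intr : int -> nzA nz) h) p q).
Qed.

Fact peval_is_multiplicative : monoid_morphism (peval h).
Proof.
have [/trivA e|nz] := eqVneq (1 : A) 0; first by split=> [|p q]; exact: e.
split=> [|p q]; first exact: (@rmorph1 _ _ (mmap (intr : int -> nzA nz) h)).
exact: (@rmorphM _ _ (mmap (intr : int -> nzA nz) h) p q).
Qed.

HB.instance Definition _ :=
  GRing.isZmodMorphism.Build {mpoly int[m]} A (peval h) peval_is_additive.
HB.instance Definition _ :=
  GRing.isMonoidMorphism.Build {mpoly int[m]} A (peval h) peval_is_multiplicative.

Lemma pevalX i : peval h 'X_i = h i.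
Proof.
have [/trivA e|nz] := eqVneq (1 : A) 0; first exact: e.
by have := mmapX (h : 'I_m -> nzA nz) intr U_(i); rewrite mmap1U.
Qed.

Lemma pevalC c : peval h c%:MP = c%:~R.
Proof.
have [/trivA e|nz] := eqVneq (1 : A) 0; first exact: e.
exact: (mmapC (h : 'I_m -> nzA nz) intr c).
Qed.

End Evaluation.

Lemma eq_peval m (A : comPzRingType) (h1 h2 : 'I_m -> A) p :
  h1 =1 h2 -> peval h1 p = peval h2 p.
Proof.
move=> eh; apply: eq_bigr => mm _; congr (_ * _).
by apply: eq_bigr => i _; rewrite eh.
Qed.

Lemma rmorph_peval m (A B : comPzRingType) (f : {rmorphism A -> B})
    (h : 'I_m -> A) p :
  f (peval h p) = peval (f \o h) p.
Proof.
rewrite /peval rmorph_sum; apply: eq_bigr => mm _.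
rewrite rmorphM rmorph_int rmorph_prod; congr (_ * _).
by apply: eq_bigr => i _; rewrite rmorphXn.
Qed.

(* Dwork's lemma: with the Frobenius lift phi : X_i -> X_i^2 on               *)
(* Z[X_0, ..., X_(m-1)], a sequence g is the ghost of a Witt vector as soon as *)
(* g_(k+1) = phi(g_k) mod 2^(k+1).                                            *)

Section Dwork.

Variable m : nat.
Local Notation B := {mpoly int[m]}.
Local Notation phi := (peval (fun i : 'I_m => 'X_i ^+ 2 : {mpoly int[m]})).

Definition modpow2 (k : nat) (a b : B) := exists c, a - b = c *+ 2 ^ k.

Lemma modpow2_refl k a : modpow2 k a a.
Proof. by exists 0; rewrite subrr mul0rn. Qed.

Lemma modpow2_trans k a b c : modpow2 k a b -> modpow2 k b c -> modpow2 k a c.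
Proof.
by case=> u eu [v ev]; exists (u + v); rewrite mulrnDl -eu -ev subrKA.
Qed.

Lemma modpow2D k a b c d :
  modpow2 k a b -> modpow2 k c d -> modpow2 k (a + c) (b + d).
Proof.
by case=> u eu [v ev]; exists (u + v); rewrite mulrnDl -eu -ev opprD addrACA.
Qed.

Lemma modpow2N k a b : modpow2 k a b -> modpow2 k (- a) (- b).
Proof. by case=> u eu; exists (- u); rewrite mulNrn -eu opprB opprK addrC. Qed.

Lemma modpow2M k a b c d :
  modpow2 k a b -> modpow2 k c d -> modpow2 k (a * c) (b * d).
Proof.
case=> u eu [v ev]; exists (u * c + b * v).
rewrite mulrnDl -mulrnAl -mulrnAr -eu -ev mulrBl mulrBr.
by rewrite subrKA.
Qed.

Lemma modpow2_sum k (I : Type) (r : seq I) (P : pred I) (F G : I -> B) :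
  (forall i, P i -> modpow2 k (F i) (G i)) ->
  modpow2 k (\sum_(i <- r | P i) F i) (\sum_(i <- r | P i) G i).
Proof.
move=> FG; elim/big_rec2: _ => [|i x y Pi xy]; first exact: modpow2_refl.
exact: modpow2D (FG i Pi) xy.
Qed.

Lemma modpow2_sqr k a b : modpow2 k.+1 a b -> modpow2 k.+2 (a ^+ 2) (b ^+ 2).
Proof.
case=> u /(canRL (subrK _)) ->; exists (b * u + u ^+ 2 *+ 2 ^ k).
rewrite sqrrD addrK exprMn_n mulrnDl addrC -!mulrnA mulrC mulrnAr -mulrnA.
rewrite -expnSr -expnM -expnD; congr (_ + _ *+ (2 ^ _)); lia.
Qed.

Lemma modpow2_exp k j a b :
  modpow2 k.+1 a b -> modpow2 (k.+1 + j) (a ^+ (2 ^ j)) (b ^+ (2 ^ j)).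
Proof.
move=> ab; elim: j => [|j IHj]; first by rewrite addn0 expn0 !expr1.
by rewrite expnSr !exprM addnS; apply: modpow2_sqr.
Qed.

Lemma modpow2Mn k j a b :
  modpow2 k a b -> modpow2 (k + j) (a *+ 2 ^ j) (b *+ 2 ^ j).
Proof.
by case=> u eu; exists u; rewrite -mulrnBl eu -mulrnA -expnD.
Qed.

Lemma phi_modpow2 p : modpow2 1 (phi p) (p ^+ 2).
Proof.
suff add2 p1 p2 : modpow2 1 (phi p1) (p1 ^+ 2) -> modpow2 1 (phi p2) (p2 ^+ 2) ->
  modpow2 1 (phi (p1 + p2)) ((p1 + p2) ^+ 2).
  elim/mpolyind: p => [|c mm p _ _ IHp].
    by rewrite rmorph0 expr0n; apply: modpow2_refl.
  apply: add2 IHp; rewrite -mul_mpolyC rmorphM exprMn; apply: modpow2M.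
    rewrite /= pevalC -(rmorph_int (@mpolyC m int)) intz -rmorphXn /=.
    have [d ed] : exists d : int, c - c ^+ 2 = d *+ 2.
      have [q [-> | ->]] : exists q : int, c = q * 2 \/ c = q * 2 + 1.
      - by exists (c %/ 2)%Z; lia.
      - by exists (q - q ^+ 2 *+ 2); ring.
      - by exists (- q - q ^+ 2 *+ 2); ring.
    by exists d%:MP; rewrite -rmorphB ed rmorphMn.
  rewrite /=; have -> : phi 'X_[mm] = 'X_[mm] ^+ 2.
    rewrite mpolyXE_id rmorph_prod -prodrXl; apply: eq_bigr => i _.
    by rewrite rmorphXn /= pevalX -!exprM mulnC.
  exact: modpow2_refl.
move=> h1 h2; rewrite rmorphD sqrrD addrAC.
apply: modpow2_trans (modpow2D h1 h2) _.
by exists (- (p1 * p2)); rewrite opprD addrA subrr add0r mulNrn.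
Qed.

Lemma phi_exp k i p : (i <= k)%N ->
  modpow2 k.+1 (phi p ^+ (2 ^ (k - i)) *+ 2 ^ i) (p ^+ (2 ^ (k.+1 - i)) *+ 2 ^ i).
Proof.
move=> ik; have := modpow2Mn i (modpow2_exp (k - i) (phi_modpow2 p)).
by rewrite -exprM -expnS -subSn // add1n addSn subnK.
Qed.

Variable n : nat.

Definition dwork_seq (g : nat -> B) :=
  forall k, (k.+1 < n)%N -> modpow2 k.+1 (g k.+1) (phi (g k)).

Lemma dwork (g : nat -> B) : dwork_seq g ->
  exists S : witt n B, [forall k : 'I_n, ghost k S == g k].
Proof.
move=> gP.
suff [x xP] : exists x : nat -> B, forall k, (k < n)%N ->
    \sum_(i < k.+1) x i ^+ (2 ^ (k - i)) *+ 2 ^ i = g k.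
  exists (mkwitt (fun i => x i)); apply/forallP => k; apply/eqP.
  rewrite -xP // /ghost (big_ord_widen n (fun i => x i ^+ (2 ^ (k - i)) *+ 2 ^ i)) //.
  by apply: eq_bigr => i _; rewrite mkwittE.
elim: {-2}n (leqnn n) => [|j IHj] lejn; first by exists (fun _ => 0).
have [x xP] := IHj (ltnW lejn).
have [c ec] : modpow2 j (g j) (\sum_(i < j) x i ^+ (2 ^ (j - i)) *+ 2 ^ i).
  case: j {IHj} lejn xP => [|j] lejn xP; first by exists (g 0); rewrite big_ord0 subr0.
  apply: modpow2_trans (gP j lejn) _; rewrite -xP // rmorph_sum.
  apply: modpow2_sum => i _; rewrite rmorphMn rmorphXn; apply: phi_exp.
  by rewrite -ltnS.
exists (fun i => if i == j then c else x i) => k.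
rewrite ltnS leq_eqVlt => /orP[/eqP -> | ltkj].
  rewrite big_ord_recr /= eqxx subnn expr1 -ec.
  rewrite (eq_bigr (fun i : 'I_j => x i ^+ (2 ^ (j - i)) *+ 2 ^ i)).
    by rewrite addrC subrK.
  by move=> i _; rewrite (ltn_eqF (ltn_ord i)).
rewrite -xP //; apply: eq_bigr => i _; rewrite ltn_eqF //.
by apply: leq_ltn_trans ltkj; rewrite -ltnS.
Qed.

End Dwork.

Lemma ghost_torsion_free_inj n (A : comPzRingType) :
    (forall j (a b : A), a *+ 2 ^ j = b *+ 2 ^ j -> a = b) ->
  forall x y : witt n A, (forall k : 'I_n, ghost k x = ghost k y) -> x = y.
Proof.
move=> tfA x y exy; apply: wittP => -[i ltin].
elim/ltn_ind: i ltin => i IHi ltin.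
have := exy (Ordinal ltin); rewrite /ghost (bigD1 (Ordinal ltin)) //=.
rewrite [RHS](bigD1 (Ordinal ltin)) //= subnn !expr1.
rewrite [X in _ + X = _](eq_bigr (fun j : 'I_n => y j ^+ (2 ^ (i - j)) *+ 2 ^ j)).
  by move/addIr/tfA.
move=> [j ltjn] /andP[/= leji neji]; rewrite IHi //.
by rewrite ltn_neqAle leji andbT; apply: contra neji => /eqP e; apply/eqP/val_inj.
Qed.

Section GhostSeq.

Variables m n : nat.
Implicit Types (g h : nat -> {mpoly int[m]}).

Lemma modpow2_weaken k (a b : {mpoly int[m]}) : modpow2 k.+1 a b -> modpow2 k a b.
Proof. by case=> u eu; exists (u *+ 2); rewrite eu expnS mulrnA. Qed.

Lemma dwork_ghost (x : witt n {mpoly int[m]}) : dwork_seq n (fun k => ghost k x).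
Proof.
move=> k ltkn; rewrite {1}/ghost (bigD1 (Ordinal ltkn)) //= subnn expr1.
rewrite -[X in modpow2 _ _ X]add0r; apply: modpow2D.
  by exists (x (Ordinal ltkn)); rewrite subr0.
rewrite (eq_bigl (fun i : 'I_n => (i <= k)%N)); last first.
  by move=> i; rewrite -val_eqE /= andbC -ltn_neqAle ltnS.
rewrite /ghost rmorph_sum; apply: modpow2_sum => i ik.
rewrite rmorphMn rmorphXn; case: (phi_exp (x i) ik) => c ec.
by exists (- c); rewrite mulNrn -ec opprB.
Qed.

Lemma dworkD g h :
  dwork_seq n g -> dwork_seq n h -> dwork_seq n (fun k => g k + h k).
Proof. by move=> gP hP k ltkn; rewrite rmorphD; apply: modpow2D; auto. Qed.

Lemma dworkN g : dwork_seq n g -> dwork_seq n (fun k => - g k).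
Proof. by move=> gP k ltkn; rewrite rmorphN; apply: modpow2N; auto. Qed.

Lemma dworkM g h :
  dwork_seq n g -> dwork_seq n h -> dwork_seq n (fun k => g k * h k).
Proof. by move=> gP hP k ltkn; rewrite rmorphM; apply: modpow2M; auto. Qed.

Lemma dwork_shift g : dwork_seq n.+1 g -> dwork_seq n (fun k => g k.+1).
Proof. by move=> gP k ltkn; apply/modpow2_weaken/gP. Qed.

Lemma mpoly_torsion_free j (a b : {mpoly int[m]}) : a *+ 2 ^ j = b *+ 2 ^ j -> a = b.
Proof.
move=> e; apply/mpolyP => mm; move/(congr1 (mcoeff mm)): e.
by rewrite !mcoeffMn; apply: pmulrnI; rewrite expn_gt0.
Qed.

Lemma ghost_inj (x y : witt n {mpoly int[m]}) :
  (forall k : 'I_n, ghost k x = ghost k y) -> x = y.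
Proof. exact/ghost_torsion_free_inj/mpoly_torsion_free. Qed.

End GhostSeq.

Definition wX n : witt n {mpoly int[n]} := mkwitt (fun i => 'X_i).
Definition wXl n : witt n {mpoly int[n + n]} := mkwitt (fun i => 'X_(lshift n i)).
Definition wXr n : witt n {mpoly int[n + n]} := mkwitt (fun i => 'X_(rshift n i)).

Fact wadd_ex n : exists S : witt n {mpoly int[n + n]},
  [forall k : 'I_n, ghost k S == ghost k (wXl n) + ghost k (wXr n)].
Proof.
by apply: (dwork (g := fun k => ghost k (wXl n) + ghost k (wXr n))); apply: dworkD; apply: dwork_ghost.
Qed.

Fact wmul_ex n : exists S : witt n {mpoly int[n + n]},
  [forall k : 'I_n, ghost k S == ghost k (wXl n) * ghost k (wXr n)].
Proof.
by apply: (dwork (g := fun k => ghost k (wXl n) * ghost k (wXr n))); apply: dworkM; apply: dwork_ghost.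
Qed.

Fact wopp_ex n : exists S : witt n {mpoly int[n]},
  [forall k : 'I_n, ghost k S == - ghost k (wX n)].
Proof.
by apply: (dwork (g := fun k => - ghost k (wX n))); apply/dworkN/dwork_ghost.
Qed.

Fact wfrob_ex n : exists S : witt n {mpoly int[n.+1]},
  [forall k : 'I_n, ghost k S == ghost k.+1 (wX n.+1)].
Proof.
by apply: (dwork (g := fun k => ghost k.+1 (wX n.+1))); apply: dwork_shift (dwork_ghost _).
Qed.

(* By ghost_inj the vectors chosen below are the only ones.                   *)
Definition wadd_poly n := xchoose (wadd_ex n).
Definition wmul_poly n := xchoose (wmul_ex n).
Definition wopp_poly n := xchoose (wopp_ex n).
Definition wfrob_poly n := xchoose (wfrob_ex n).

Definition wpair n A (x y : witt n A) (i : 'I_(n + n)) : A :=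
  match split i with inl j => x j | inr j => y j end.

Lemma ghost_peval m n (A : comPzRingType) (h : 'I_m -> A) k
    (p : witt n {mpoly int[m]}) :
  ghost k (witt_map (peval h) p) = peval h (ghost k p).
Proof. exact: (ghost_map (peval h : {rmorphism _ -> _})). Qed.

Lemma split_lshift m n (i : 'I_m) : split (lshift n i) = inl i.
Proof. exact: (unsplitK (inl i)). Qed.

Lemma split_rshift m n (i : 'I_n) : split (rshift m i) = inr i.
Proof. exact: (unsplitK (inr i)). Qed.

Section Operations.

Variables (n : nat) (A : comPzRingType).
Implicit Types x y z : witt n A.

Definition witt_add x y := witt_map (peval (wpair x y)) (wadd_poly n).
Definition witt_mul x y := witt_map (peval (wpair x y)) (wmul_poly n).
Definition witt_opp x := witt_map (peval x) (wopp_poly n).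

Definition teich (a : A) : witt n A :=
  mkwitt (fun i => if i == 0 :> nat then a else 0).

Definition witt_zero : witt n A := mkwitt (fun=> 0).

Definition witt_res (x : witt n.+1 A) : witt n A :=
  mkwitt (fun i => x (widen_ord (leqnSn n) i)).

Definition witt_ver (x : witt n A) : witt n.+1 A :=
  mkwitt (fun i => if unlift ord0 i is Some j then x j else 0).

Definition witt_frob (x : witt n.+1 A) : witt n A :=
  witt_map (peval x) (wfrob_poly n).

Lemma wXlE x y : witt_map (peval (wpair x y)) (wXl n) = x.
Proof.
by apply: wittP => i; rewrite !mkwittE pevalX /wpair split_lshift.
Qed.

Lemma wXrE x y : witt_map (peval (wpair x y)) (wXr n) = y.
Proof.
by apply: wittP => i; rewrite !mkwittE pevalX /wpair split_rshift.
Qed.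

Lemma wXE x : witt_map (peval x) (wX n) = x.
Proof. by apply: wittP => i; rewrite !mkwittE pevalX. Qed.

Lemma ghost_add (k : 'I_n) x y : ghost k (witt_add x y) = ghost k x + ghost k y.
Proof.
rewrite ghost_peval (eqP (forallP (xchooseP (wadd_ex n)) k)) rmorphD.
by congr (_ + _); rewrite /= -ghost_peval ?wXlE ?wXrE.
Qed.

Lemma ghost_mul (k : 'I_n) x y : ghost k (witt_mul x y) = ghost k x * ghost k y.
Proof.
rewrite ghost_peval (eqP (forallP (xchooseP (wmul_ex n)) k)) rmorphM.
by congr (_ * _); rewrite /= -ghost_peval ?wXlE ?wXrE.
Qed.

Lemma ghost_opp (k : 'I_n) x : ghost k (witt_opp x) = - ghost k x.
Proof.
rewrite ghost_peval (eqP (forallP (xchooseP (wopp_ex n)) k)) rmorphN.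
by rewrite /= -ghost_peval wXE.
Qed.

Lemma ghost_teich (k : 'I_n) a : ghost k (teich a) = a ^+ (2 ^ k).
Proof.
case: k => k ltkn; have lt0n := leq_ltn_trans (leq0n k) ltkn.
rewrite /ghost (bigD1 (Ordinal lt0n)) //= mkwittE eqxx subn0 mulr1n.
rewrite big1 ?addr0 // => i /andP[_ nei]; rewrite mkwittE.
by rewrite -val_eqE /= in nei; rewrite (negPf nei) expr0n expn_eq0 mul0rn.
Qed.

Lemma ghost_zero (k : 'I_n) : ghost k witt_zero = 0 :> A.
Proof.
by rewrite /ghost big1 // => i _; rewrite mkwittE expr0n expn_eq0 mul0rn.
Qed.

End Operations.

Arguments teich n {A} a.

Lemma ghost_frob n (A : comPzRingType) (k : 'I_n) (x : witt n.+1 A) :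
  ghost k (witt_frob x) = ghost k.+1 x.
Proof.
rewrite ghost_peval (eqP (forallP (xchooseP (wfrob_ex n)) k)).
by rewrite /= -ghost_peval wXE.
Qed.

Lemma ghost_ver0 n (A : comPzRingType) (x : witt n A) : ghost 0 (witt_ver x) = 0.
Proof.
rewrite /ghost big1 // => i; rewrite leqn0 => /eqP i0.
by rewrite mkwittE (_ : i = ord0) ?unlift_none ?expr0n //; apply: val_inj.
Qed.

Lemma ghost_verS n (A : comPzRingType) (k : nat) (x : witt n A) :
  ghost k.+1 (witt_ver x) = ghost k x *+ 2.
Proof.
rewrite /ghost big_mkcond big_ord_recl /= mkwittE unlift_none.
rewrite expr0n expn_eq0 mul0rn add0r -sumrMnl [RHS]big_mkcond /=.
by apply: eq_bigr => i _; rewrite mkwittE liftK -mulrnA -expnSr.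
Qed.

Lemma ghost_res n (A : comPzRingType) (k : 'I_n) (x : witt n.+1 A) :
  ghost k (witt_res x) = ghost k x.
Proof.
rewrite /ghost [RHS]big_mkcond big_ord_recr /= leqNgt ltn_ord /= addr0.
by rewrite [LHS]big_mkcond; apply: eq_bigr => i _; rewrite mkwittE.
Qed.

Section Naturality.

Variables (n : nat) (A B : comPzRingType) (f : {rmorphism A -> B}).
Implicit Types x y : witt n A.

Let map_peval m l (h : 'I_m -> A) (h' : 'I_m -> B) (p : witt l {mpoly int[m]}) :
  f \o h =1 h' -> witt_map f (witt_map (peval h) p) = witt_map (peval h') p.
Proof.
move=> eh; apply: wittP => i; rewrite !mkwittE rmorph_peval; exact: eq_peval.
Qed.

Let fpair x y : f \o wpair x y =1 wpair (witt_map f x) (witt_map f y).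
Proof. by move=> i; rewrite /wpair /=; case: split => j; rewrite mkwittE. Qed.

Lemma witt_map_add x y :
  witt_map f (witt_add x y) = witt_add (witt_map f x) (witt_map f y).
Proof. exact/map_peval/fpair. Qed.

Lemma witt_map_mul x y :
  witt_map f (witt_mul x y) = witt_mul (witt_map f x) (witt_map f y).
Proof. exact/map_peval/fpair. Qed.

Lemma witt_map_opp x : witt_map f (witt_opp x) = witt_opp (witt_map f x).
Proof. by apply: map_peval => i; rewrite mkwittE. Qed.

Lemma witt_map_teich a : witt_map f (teich n a) = teich n (f a).
Proof. by apply: wittP => i; rewrite !mkwittE; case: ifP; rewrite ?rmorph0. Qed.

Lemma witt_map_zero : witt_map f (witt_zero n A) = witt_zero n B.
Proof. by apply: wittP => i; rewrite !mkwittE rmorph0. Qed.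

End Naturality.

Lemma witt_lift3 n (A : comPzRingType) (x y z : witt n A) :
  exists (B : comPzRingType) (f : {rmorphism B -> A}) X Y Z,
    [/\ forall j (a b : B), a *+ 2 ^ j = b *+ 2 ^ j -> a = b,
        witt_map f X = x, witt_map f Y = y & witt_map f Z = z].
Proof.
pose h (i : 'I_(n + n + n)) :=
  match split i with inl j => wpair x y j | inr j => z j end.
exists {mpoly int[n + n + n]}, (peval h : {rmorphism _ -> _}).
exists (mkwitt (fun i => 'X_(lshift n (lshift n i)))).
exists (mkwitt (fun i => 'X_(lshift n (rshift n i)))).
exists (mkwitt (fun i => 'X_(rshift (n + n) i))).
by split; first exact: mpoly_torsion_free;
  apply: wittP => i; rewrite !mkwittE /= pevalX /h /wpair
  ?split_rshift ?split_lshift ?split_rshift ?split_lshift.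
Qed.

Section WittRing.

Variables (n : nat) (A : comPzRingType).
Local Notation W := (witt n A).
Local Notation add := (@witt_add n A).
Local Notation mul := (@witt_mul n A).
Local Notation opp := (@witt_opp n A).
Local Notation zero := (witt_zero n A).
Local Notation one := (teich n (1 : A)).

Let ghostE B := (@ghost_add n B, @ghost_mul n B, @ghost_opp n B, @ghost_teich n B,
  @ghost_zero n B).
Let mapE B C f := (@witt_map_add n B C f, @witt_map_mul n B C f,
  @witt_map_opp n B C f, @witt_map_teich n B C f, @witt_map_zero n B C f).

Fact witt_addA : associative add.
Proof.
move=> x y z; have [B [f [X [Y [Z [tfB <- <- <-]]]]]] := witt_lift3 x y z.
by rewrite -!mapE; congr witt_map; apply: (ghost_torsion_free_inj tfB) => k; rewrite !ghostE addrA.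
Qed.

Fact witt_addC : commutative add.
Proof.
move=> x y; have [B [f [X [Y [_ [tfB <- <- _]]]]]] := witt_lift3 x y x.
by rewrite -!mapE; congr witt_map; apply: (ghost_torsion_free_inj tfB) => k; rewrite !ghostE addrC.
Qed.

Fact witt_add0 : left_id zero add.
Proof.
move=> x; have [B [f [X [_ [_ [tfB <- _ _]]]]]] := witt_lift3 x x x.
rewrite -(witt_map_zero n f) -!mapE; congr witt_map.
by apply: (ghost_torsion_free_inj tfB) => k; rewrite !ghostE add0r.
Qed.

Fact witt_addN : left_inverse zero opp add.
Proof.
move=> x; have [B [f [X [_ [_ [tfB <- _ _]]]]]] := witt_lift3 x x x.
rewrite -(witt_map_zero n f) -!mapE; congr witt_map.
by apply: (ghost_torsion_free_inj tfB) => k; rewrite !ghostE addNr.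
Qed.

Fact witt_mulA : associative mul.
Proof.
move=> x y z; have [B [f [X [Y [Z [tfB <- <- <-]]]]]] := witt_lift3 x y z.
by rewrite -!mapE; congr witt_map; apply: (ghost_torsion_free_inj tfB) => k; rewrite !ghostE mulrA.
Qed.

Fact witt_mulC : commutative mul.
Proof.
move=> x y; have [B [f [X [Y [_ [tfB <- <- _]]]]]] := witt_lift3 x y x.
by rewrite -!mapE; congr witt_map; apply: (ghost_torsion_free_inj tfB) => k; rewrite !ghostE mulrC.
Qed.

Fact witt_mul1 : left_id one mul.
Proof.
move=> x; have [B [f [X [_ [_ [tfB <- _ _]]]]]] := witt_lift3 x x x.
rewrite -(rmorph1 f) -!mapE; congr witt_map.
by apply: (ghost_torsion_free_inj tfB) => k; rewrite !ghostE expr1n mul1r.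
Qed.

Fact witt_mulDl : left_distributive mul add.
Proof.
move=> x y z; have [B [f [X [Y [Z [tfB <- <- <-]]]]]] := witt_lift3 x y z.
by rewrite -!mapE; congr witt_map; apply: (ghost_torsion_free_inj tfB) => k; rewrite !ghostE mulrDl.
Qed.

HB.instance Definition _ :=
  GRing.isZmodule.Build W witt_addA witt_addC witt_add0 witt_addN.
HB.instance Definition _ :=
  GRing.Zmodule_isComPzRing.Build W witt_mulA witt_mulC witt_mul1 witt_mulDl.

Lemma teich1 : teich n 1 = 1 :> W.
Proof. by []. Qed.

Lemma teichM (a b : A) : teich n (a * b) = teich n a * teich n b.
Proof.
have [B [f [X [Y [_ [tfB eX eY _]]]]]] :=
  witt_lift3 (teich 1 a) (teich 1 b) (teich 1 a).
have [-> ->] : a = f (X ord0) /\ b = f (Y ord0).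
  split; [move: eX | move: eY] => /(congr1 (fun w => wfun w ord0));
    by rewrite !mkwittE.
rewrite -rmorphM -!mapE -[RHS](witt_map_mul f); congr witt_map.
by apply: (ghost_torsion_free_inj tfB) => k; rewrite !ghostE exprMn.
Qed.

Lemma teichN1_sqr : teich n (-1) * teich n (-1) = 1 :> W.
Proof. by rewrite -teichM mulrNN mulr1. Qed.

End WittRing.

(* A graded-commutative ring is given by its homogeneous components E^q. The  *)
(* product E^p x E^q -> E^r takes a proof of p + q = r, so that the laws can  *)
(* be stated without casts between E^(p + q) and E^(q + p).                   *)

Record gring := GRingPack {
  gr_sort :> nat -> zmodType;
  gr_one : gr_sort 0%N;
  gr_mul : forall p q r, (p + q = r)%N -> gr_sort p -> gr_sort q -> gr_sort r;
  gr_mulDl : forall p q r (h : (p + q = r)%N) (x y : gr_sort p) (z : gr_sort q),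
    gr_mul h (x + y) z = gr_mul h x z + gr_mul h y z;
  gr_mulDr : forall p q r (h : (p + q = r)%N) (x : gr_sort p) (y z : gr_sort q),
    gr_mul h x (y + z) = gr_mul h x y + gr_mul h x z;
  gr_mul1l : forall p (h : (0 + p = p)%N) (x : gr_sort p), gr_mul h gr_one x = x;
  gr_mul1r : forall p (h : (p + 0 = p)%N) (x : gr_sort p), gr_mul h x gr_one = x;
  gr_mulA : forall p q r pq qr s
      (hpq : (p + q = pq)%N) (hqr : (q + r = qr)%N)
      (hl : (pq + r = s)%N) (hr : (p + qr = s)%N)
      (x : gr_sort p) (y : gr_sort q) (z : gr_sort r),
    gr_mul hl (gr_mul hpq x y) z = gr_mul hr x (gr_mul hqr y z);
  gr_mulC : forall p q r (hl : (p + q = r)%N) (hr : (q + p = r)%N)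
      (x : gr_sort p) (y : gr_sort q),
    gr_mul hl x y = gr_mul hr y x *~ (-1) ^+ (p * q)
}.

Arguments gr_one {g}.
Arguments gr_mul {g p q r} h x y.

Record gmor (E E' : gring) := GMor {
  gm_fun :> forall q, {additive E q -> E' q};
  gm_one : gm_fun 0%N gr_one = gr_one;
  gm_mul : forall p q r (h : (p + q = r)%N) (x : E p) (y : E q),
    gm_fun r (gr_mul h x y) = gr_mul h (gm_fun p x) (gm_fun q y)
}.

Definition deg0 (E : gring) : Type := E 0%N.

Section Degree0.

Variable E : gring.
Local Notation mul0 := (gr_mul (g := E) (addn0 0%N)).

HB.instance Definition _ := GRing.Zmodule.on (deg0 E).

Fact deg0_mulA : associative mul0.
Proof. by move=> x y z; rewrite (gr_mulA _ (addn0 0%N) _ (addn0 0%N)). Qed.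

Fact deg0_mulC : commutative mul0.
Proof. by move=> x y; rewrite (gr_mulC _ (addn0 0%N)) mulr1z. Qed.

Fact deg0_mul1 : left_id gr_one mul0.
Proof. by move=> x; exact: gr_mul1l. Qed.

Fact deg0_mulDl : left_distributive mul0 +%R.
Proof. by move=> x y z; exact: gr_mulDl. Qed.

HB.instance Definition _ := GRing.Zmodule_isComPzRing.Build (deg0 E)
  deg0_mulA deg0_mulC deg0_mul1 deg0_mulDl.

End Degree0.

(* Levels are indexed by n : nat with E_0 = 0: the levels n < 0 vanish, hence *)
(* carry no information, and R, F : E_(n+1) -> E_n and V : E_n -> E_(n+1) are *)
(* determined by their components with n : nat.                               *)

Record preWitt (A : comPzRingType) := PreWitt {
  pw_E :> nat -> gring;
  pw_R : forall n, gmor (pw_E n.+1) (pw_E n);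
  pw_lam : forall n, {rmorphism witt n A -> deg0 (pw_E n)};
  pw_F : forall n, gmor (pw_E n.+1) (pw_E n);
  pw_V : forall n q, {additive pw_E n q -> pw_E n.+1 q};
  pw_d : forall n q, {additive pw_E n q -> pw_E n q.+1}
}.

Section WittAxioms.

Variables (A : comPzRingType) (E : preWitt A).

(* d lambda([-1]_n) / lambda([-1]_n); by teichN1_sqr, [-1]_n is its own       *)
(* inverse.                                                                   *)
Definition dlogN1 n : E n 1%N :=
  gr_mul (addn0 1%N) (pw_d E n 0%N (pw_lam E n (teich n (-1)))) (pw_lam E n (teich n (-1))).

Definition wiota n q (x : E n q) : E n q.+1 := gr_mul (add1n q) (dlogN1 n) x.

Record isWitt : Prop := IsWitt {
  wE0 : forall q (x : E 0%N q), x = 0;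

  wRlam : forall n (a : witt n.+1 A),
    pw_R E n 0%N (pw_lam E n.+1 a) = pw_lam E n (witt_res a);

  wRF : forall n q (x : E n.+2 q),
    pw_R E n q (pw_F E n.+1 q x) = pw_F E n q (pw_R E n.+1 q x);
  wFlam : forall n (a : witt n.+1 A),
    pw_F E n 0%N (pw_lam E n.+1 a) = pw_lam E n (witt_frob a);

  wRV : forall n q (x : E n.+1 q),
    pw_R E n.+1 q (pw_V E n.+1 q x) = pw_V E n q (pw_R E n q x);
  wVF : forall n p q r (h : (p + q = r)%N) (x : E n p) (y : E n.+1 q),
    gr_mul h (pw_V E n p x) y = pw_V E n r (gr_mul h x (pw_F E n q y));
  wVlam : forall n (a : witt n A),
    pw_V E n 0%N (pw_lam E n a) = pw_lam E n.+1 (witt_ver a);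
  wFV : forall n q (x : E n q), pw_F E n q (pw_V E n q x) = x *+ 2;

  wRd : forall n q (x : E n.+1 q),
    pw_R E n q.+1 (pw_d E n.+1 q x) = pw_d E n q (pw_R E n q x);
  wdM : forall n p q r (h : (p + q = r)%N) (hl : (p.+1 + q = r.+1)%N)
      (hr : (p + q.+1 = r.+1)%N) (x : E n p) (y : E n q),
    pw_d E n r (gr_mul h x y) =
    gr_mul hl (pw_d E n p x) y + gr_mul hr x (pw_d E n q y) *~ (-1) ^+ p;

  wFdV : forall n q (x : E n q),
    pw_F E n q.+1 (pw_d E n.+1 q (pw_V E n q x)) = pw_d E n q x + wiota x;
  wdd : forall n q (x : E n q), pw_d E n q.+1 (pw_d E n q x) = pw_d E n q.+1 (wiota x);
  wd_iota : forall n q (x : E n q), pw_d E n q.+1 (wiota x) = wiota (pw_d E n q x);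
  wFd_teich : forall n (a : A),
    pw_F E n 1%N (pw_d E n.+1 0%N (pw_lam E n.+1 (teich n.+1 a))) =
    gr_mul (add0n 1%N) (pw_lam E n (teich n a)) (pw_d E n 0%N (pw_lam E n (teich n a)))
}.

End WittAxioms.

Record wittComplex (A : comPzRingType) := WittComplex {
  wc_pre :> preWitt A;
  wc_axioms : isWitt wc_pre
}.

(* Maps of pro-objects are strict.                                            *)
Record wittMor (A : comPzRingType) (E E' : wittComplex A) := WittMor {
  wm_fun :> forall n, gmor (E n) (E' n);
  wm_R : forall n q (x : E n.+1 q),
    wm_fun n q (pw_R E n q x) = pw_R E' n q (wm_fun n.+1 q x);
  wm_lam : forall n (a : witt n A), wm_fun n 0%N (pw_lam E n a) = pw_lam E' n a;
  wm_d : forall n q (x : E n q),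
    wm_fun n q.+1 (pw_d E n q x) = pw_d E' n q (wm_fun n q x);
  wm_F : forall n q (x : E n.+1 q),
    wm_fun n q (pw_F E n q x) = pw_F E' n q (wm_fun n.+1 q x);
  wm_V : forall n q (x : E n q),
    wm_fun n.+1 q (pw_V E n q x) = pw_V E' n q (wm_fun n q x)
}.

(* Monoids are written multiplicatively and need not be commutative.          *)
Notation monoidMap M N := (UMagmaMorphism.type M N).

Record preLog (M : monoidType) (A : comPzRingType) := PreLog {
  pl_fun :> M -> A;
  pl_one : pl_fun 1%g = 1;
  pl_mul : forall a b, pl_fun (a * b)%g = pl_fun a * pl_fun b
}.

Section WittLog.

Variables (A : comPzRingType) (M : monoidType) (alpha : preLog M A).

Definition witt_preLog n : preLog M (witt n A).
Proof.
exists (fun a => teich n (alpha a)); first by rewrite pl_one.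
by move=> a b; rewrite pl_mul teichM.
Defined.

Record preLogWitt := PreLogWitt {
  lw_witt :> wittComplex A;
  lw_mon : monoidType;
  lw_alpha : forall n, preLog lw_mon (deg0 (lw_witt n));
  lw_dlog : forall n, lw_mon -> lw_witt n 1%N;
  lw_lam : monoidMap M lw_mon
}.

Arguments lw_alpha : clear implicits.
Arguments lw_dlog : clear implicits.
Arguments lw_lam : clear implicits.

Record isLogWitt (E : preLogWitt) : Prop := IsLogWitt {
  lw_dlog1 : forall n, lw_dlog E n 1%g = 0;
  lw_dlogM : forall n (a b : lw_mon E),
    lw_dlog E n (a * b)%g = lw_dlog E n a + lw_dlog E n b;
  lw_Rdlog : forall n (a : lw_mon E), pw_R E n 1%N (lw_dlog E n.+1 a) = lw_dlog E n a;

  (* d is a derivation of E_n^0 by wdM. *)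
  lw_dlog_der : forall n (a : lw_mon E),
    gr_mul (add0n 1%N) (lw_alpha E n a) (lw_dlog E n a) = pw_d E n 0%N (lw_alpha E n a);

  lw_lam_alpha : forall n (a : M),
    lw_alpha E n (lw_lam E a) = pw_lam E n (witt_preLog n a);

  lw_Ralpha : forall n (a : lw_mon E), pw_R E n 0%N (lw_alpha E n.+1 a) = lw_alpha E n a;

  lw_d_dlog : forall n (a : M), pw_d E n 1%N (lw_dlog E n (lw_lam E a)) = 0;

  lw_Fdlog : forall n (a : M),
    pw_F E n 1%N (lw_dlog E n.+1 (lw_lam E a)) = lw_dlog E n (lw_lam E a)
}.

Record logWitt := LogWitt {
  lw_pre :> preLogWitt;
  lw_axioms : isLogWitt lw_pre
}.

Record logWittMor (E E' : logWitt) := LogWittMor {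
  lm_witt :> wittMor E E';
  lm_mon : monoidMap (lw_mon E) (lw_mon E');
  lm_lam : forall a : M, lm_mon (lw_lam E a) = lw_lam E' a;
  lm_alpha : forall n (a : lw_mon E),
    lm_witt n 0%N (lw_alpha E n a) = lw_alpha E' n (lm_mon a);
  lm_dlog : forall n (a : lw_mon E),
    lm_witt n 1%N (lw_dlog E n a) = lw_dlog E' n (lm_mon a)
}.

Definition logWittMor_eq (E E' : logWitt) (f g : logWittMor E E') : Prop :=
  (forall n q (x : E n q), f n q x = g n q x) /\
  (forall a : lw_mon E, lm_mon f a = lm_mon g a).

Definition isInitial (E : logWitt) : Prop :=
  forall E' : logWitt,
    exists f : logWittMor E E', forall g : logWittMor E E', logWittMor_eq g f.

End WittLog.

Arguments lw_alpha {A M} E n : rename.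
Arguments lw_dlog {A M} E n : rename.
Arguments lw_lam {A M} E : rename.

(* Main.v *)
Require Import Defs.
From HB Require Import structures.
From mathcomp Require Import all_boot all_order all_algebra.
From mathcomp Require Import boolp.

(** All the axioms of a Witt complex over a log-ring are equations between
    sorted terms, so the initial object is the term model.  Two terms are
    identified when they take the same value in every Witt complex over
    [(A, M)]; every axiom then holds in the quotient because it holds in each
    complex.  No terms for the monoid are needed: the monoid of the initial
    object is [M] itself. *)

Set Implicit Arguments.
Unset Strict Implicit.
Unset Printing Implicit Defensive.

Import GRing.Theory.
Local Open Scope ring_scope.
Local Open Scope quotient_scope.

Section TermModel.

(** * Terms and their values in a complex *)

Variables (A : comPzRingType) (M : monoidType) (alpha : preLog M A).

(** The indices are the level and the degree. [TMul] carries a degree equation, as [gr_mul] does.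
    There is no constructor for the [alpha_n]: on the image of [M] they are values of [lambda], by
    [lw_lam_alpha]. *)
Inductive term : nat -> nat -> Type :=
| TZero n q : term n q
| TOpp n q : term n q -> term n q
| TAdd n q : term n q -> term n q -> term n q
| TOne n : term n 0
| TMul n p q r : (p + q = r)%N -> term n p -> term n q -> term n r
| TR n q : term n.+1 q -> term n q
| TLam n : witt n A -> term n 0
| TF n q : term n.+1 q -> term n q
| TV n q : term n q -> term n.+1 q
| TD n q : term n q -> term n q.+1
| TDlog n : M -> term n 1.

HB.instance Definition _ n q := gen_eqMixin (term n q).
HB.instance Definition _ n q := gen_choiceMixin (term n q).

Fixpoint eval (E : logWitt alpha) n q (t : term n q) : E n q :=
  match t with
  | TZero _ _ => 0
  | TOpp _ _ t => - eval E t
  | TAdd _ _ t u => eval E t + eval E u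
  | TOne _ => gr_one
  | TMul _ _ _ _ h t u => gr_mul h (eval E t) (eval E u)
  | TR _ _ t => pw_R E _ _ (eval E t)
  | TLam n w => pw_lam E n w
  | TF _ _ t => pw_F E _ _ (eval E t)
  | TV _ _ t => pw_V E _ _ (eval E t)
  | TD _ _ t => pw_d E _ _ (eval E t)
  | TDlog n a => lw_dlog E n (lw_lam E a)
  end.

(** The complexes form a large collection, but [Prop] is impredicative, so the relation and its
    quotient stay small, and the term model can itself be one of the [E]. *)
Definition term_eqv n q (t u : term n q) : bool :=
  `[< forall E : logWitt alpha, eval E t = eval E u >].

Fact term_eqv_equiv n q : equiv_class_of (@term_eqv n q).
Proof.
split=> [t | t u | u t v]; first by apply/asboolP.
  by apply/asboolP/asboolP => e E; rewrite e.
by move=> /asboolP e1 /asboolP e2; apply/asboolP => E; rewrite e1.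
Qed.

(** * Classes of terms and their values *)

Canonical term_equiv n q := EquivRelPack (@term_eqv_equiv n q).

Definition tquot n q := {eq_quot (@term_equiv n q)}.

HB.instance Definition _ n q := Choice.on (tquot n q).

Definition tpi n q (t : term n q) : tquot n q := \pi t.
Definition trep n q (x : tquot n q) : term n q := repr x.
Definition qeval (E : logWitt alpha) n q (x : tquot n q) : E n q := eval E (trep x).

Lemma tpiK n q (x : tquot n q) : tpi (trep x) = x.
Proof. exact: reprK. Qed.

(** The representative chosen for the class of [t] is equivalent to [t], hence has the same value in
    every complex. *)
Lemma qeval_pi E n q (t : term n q) : qeval E (tpi t) = eval E t.
Proof. by have /eqmodP/asboolP := reprK (tpi t); apply. Qed.

(** By the choice of the relation, evaluations are jointly injective. An identity between classes
    thus reduces to the same identity in an arbitrary [E]. *)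
Lemma qeval_inj n q (x y : tquot n q) :
  (forall E, qeval E x = qeval E y) -> x = y.
Proof. by move=> e; rewrite -[x]tpiK -[y]tpiK; apply/eqmodP/asboolP. Qed.

(** * Operations on classes *)

Definition qzero n q : tquot n q := tpi (TZero n q).
(** Working with chosen representatives is harmless: the value of a compound term depends only on
    the values of its parts. *)
Definition qopp n q (x : tquot n q) := tpi (TOpp (trep x)).
Definition qadd n q (x y : tquot n q) := tpi (TAdd (trep x) (trep y)).
Definition qone n : tquot n 0 := tpi (TOne n).
Definition qmul n p q r (h : (p + q = r)%N) (x : tquot n p) (y : tquot n q) :=
  tpi (TMul h (trep x) (trep y)).
Definition qR n q (x : tquot n.+1 q) := tpi (TR (trep x)).
Definition qlam n (w : witt n A) := tpi (TLam w).
Definition qF n q (x : tquot n.+1 q) := tpi (TF (trep x)).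
Definition qV n q (x : tquot n q) := tpi (TV (trep x)).
Definition qd n q (x : tquot n q) := tpi (TD (trep x)).
Definition qdlog n (a : M) := tpi (TDlog n a).

Lemma qeval_zero E n q : qeval E (qzero n q) = 0.
Proof. exact: qeval_pi. Qed.

Lemma qeval_opp E n q (x : tquot n q) : qeval E (qopp x) = - qeval E x.
Proof. exact: qeval_pi. Qed.

Lemma qeval_add E n q (x y : tquot n q) : qeval E (qadd x y) = qeval E x + qeval E y.
Proof. exact: qeval_pi. Qed.

Lemma qeval_mul E n p q r (h : (p + q = r)%N) (x : tquot n p) (y : tquot n q) :
  qeval E (qmul h x y) = gr_mul h (qeval E x) (qeval E y).
Proof. exact: qeval_pi. Qed.

Lemma qeval_R E n q (x : tquot n.+1 q) : qeval E (qR x) = pw_R E n q (qeval E x).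
Proof. exact: qeval_pi. Qed.

Lemma qeval_F E n q (x : tquot n.+1 q) : qeval E (qF x) = pw_F E n q (qeval E x).
Proof. exact: qeval_pi. Qed.

Lemma qeval_V E n q (x : tquot n q) : qeval E (qV x) = pw_V E n q (qeval E x).
Proof. exact: qeval_pi. Qed.

Lemma qeval_d E n q (x : tquot n q) : qeval E (qd x) = pw_d E n q (qeval E x).
Proof. exact: qeval_pi. Qed.

Lemma qeval_one E n : qeval E (qone n) = gr_one.
Proof. exact: qeval_pi. Qed.

Lemma qeval_lam E n (w : witt n A) : qeval E (qlam w) = pw_lam E n w.
Proof. exact: qeval_pi. Qed.

Lemma qeval_dlog E n (a : M) : qeval E (qdlog n a) = lw_dlog E n (lw_lam E a).
Proof. exact: qeval_pi. Qed.

Definition qevalE :=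
  (qeval_zero, qeval_opp, qeval_add, qeval_mul, qeval_R, qeval_F, qeval_V, qeval_d, qeval_one,
  qeval_lam, qeval_dlog).

(** * The graded ring at each level *)

Fact qaddA n q : associative (@qadd n q).
Proof. by move=> x y z; apply: qeval_inj => E; rewrite !qevalE addrA. Qed.

Fact qaddC n q : commutative (@qadd n q).
Proof. by move=> x y; apply: qeval_inj => E; rewrite !qevalE addrC. Qed.

Fact qadd0 n q : left_id (qzero n q) (@qadd n q).
Proof. by move=> x; apply: qeval_inj => E; rewrite !qevalE add0r. Qed.

Fact qaddN n q : left_inverse (qzero n q) (@qopp n q) (@qadd n q).
Proof. by move=> x; apply: qeval_inj => E; rewrite !qevalE addNr. Qed.

HB.instance Definition _ n q :=
  GRing.isZmodule.Build (tquot n q) (@qaddA n q) (@qaddC n q) (@qadd0 n q) (@qaddN n q).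

(** Evaluation can then pass through the integer multiples that express signs and the factor 2,
    which are not term constructors. *)
Fact qeval_additive E n q : zmod_morphism (@qeval E n q).
Proof. by move=> x y; rewrite [LHS]qeval_add qeval_opp. Qed.

HB.instance Definition _ (E : logWitt alpha) n q :=
  GRing.isZmodMorphism.Build (tquot n q) (E n q) (@qeval E n q) (@qeval_additive E n q).

Definition tring (n : nat) : gring.
Proof.
exists (fun q => tquot n q : zmodType) (qone n) (@qmul n).
- by move=> p q r h x y z; apply: qeval_inj => E; rewrite raddfD /= !qevalE gr_mulDl.
- by move=> p q r h x y z; apply: qeval_inj => E; rewrite raddfD /= !qevalE gr_mulDr.
- by move=> p h x; apply: qeval_inj => E; rewrite !qevalE gr_mul1l.
- by move=> p h x; apply: qeval_inj => E; rewrite !qevalE gr_mul1r.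
- move=> p q r pq qr s hpq hqr hl hr x y z; apply: qeval_inj => E.
  by rewrite !qevalE; apply: gr_mulA.
- move=> p q r hl hr x y; apply: qeval_inj => E.
  by rewrite raddfMz /= !qevalE; apply: gr_mulC.
Defined.

(** * The structure maps *)

Fact qR_additive n q : zmod_morphism (@qR n q).
Proof. by move=> x y; apply: qeval_inj => E; rewrite raddfB /= !qevalE !raddfB. Qed.
Fact qF_additive n q : zmod_morphism (@qF n q).
Proof. by move=> x y; apply: qeval_inj => E; rewrite raddfB /= !qevalE !raddfB. Qed.
Fact qV_additive n q : zmod_morphism (@qV n q).
Proof. by move=> x y; apply: qeval_inj => E; rewrite raddfB /= !qevalE !raddfB. Qed.
Fact qd_additive n q : zmod_morphism (@qd n q).
Proof. by move=> x y; apply: qeval_inj => E; rewrite raddfB /= !qevalE !raddfB. Qed.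

HB.instance Definition _ n q := GRing.isZmodMorphism.Build
  (tring n.+1 q) (tring n q) (@qR n q) (@qR_additive n q).
HB.instance Definition _ n q := GRing.isZmodMorphism.Build
  (tring n.+1 q) (tring n q) (@qF n q) (@qF_additive n q).
HB.instance Definition _ n q := GRing.isZmodMorphism.Build
  (tring n q) (tring n.+1 q) (@qV n q) (@qV_additive n q).
HB.instance Definition _ n q := GRing.isZmodMorphism.Build
  (tring n q) (tring n q.+1) (@qd n q) (@qd_additive n q).

Definition tring_R n : gmor (tring n.+1) (tring n).
Proof.
exists (fun q => @qR n q : {additive tring n.+1 q -> tring n q}).
  by apply: qeval_inj => E; rewrite !qevalE gm_one.
by move=> p q r h x y; apply: qeval_inj => E; rewrite !qevalE gm_mul.
Defined.

Definition tring_F n : gmor (tring n.+1) (tring n).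
Proof.
exists (fun q => @qF n q : {additive tring n.+1 q -> tring n q}).
  by apply: qeval_inj => E; rewrite !qevalE gm_one.
by move=> p q r h x y; apply: qeval_inj => E; rewrite !qevalE gm_mul.
Defined.

Fact qlam_additive n : zmod_morphism (@qlam n : witt n A -> deg0 (tring n)).
Proof.
by move=> x y; apply: qeval_inj => E; rewrite [RHS]qeval_add qeval_opp !qevalE rmorphB.
Qed.

Fact qlam_multiplicative n : monoid_morphism (@qlam n : witt n A -> deg0 (tring n)).
Proof.
split=> [|x y]; apply: qeval_inj => E.
  by rewrite [RHS]qeval_one qeval_lam rmorph1.
by rewrite [RHS]qeval_mul !qeval_lam rmorphM.
Qed.

Definition tlam n : {rmorphism witt n A -> deg0 (tring n)} :=
  HB.pack (@qlam n : witt n A -> deg0 (tring n))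
    (GRing.isZmodMorphism.Build _ _ _ (@qlam_additive n))
    (GRing.isMonoidMorphism.Build _ _ _ (@qlam_multiplicative n)).

(** * The axioms of a Witt complex *)

Definition tpreWitt : preWitt A :=
  @PreWitt A tring tring_R tlam
    tring_F (fun n q => @qV n q : {additive tring n q -> tring n.+1 q})
    (fun n q => @qd n q : {additive tring n q -> tring n q.+1}).

(** [wiota] is built from [d], [lambda] and the product, with which evaluation commutes. *)
Lemma qeval_iota E n q (x : tquot n q) :
  qeval E (wiota (E := tpreWitt) x) = wiota (qeval E x).
Proof. by rewrite /wiota /dlogN1 /= !qevalE. Qed.

Lemma tpreWitt_axioms : isWitt tpreWitt.
Proof.
split=> /=.
(* Both values lie in level 0 of [E], which vanishes. *)
- move=> q x; apply: qeval_inj => E.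
  by rewrite [LHS](wE0 (wc_axioms E)) [RHS](wE0 (wc_axioms E)).
- by move=> n w; apply: qeval_inj => E; rewrite !qevalE (wRlam (wc_axioms E)).
- by move=> n q x; apply: qeval_inj => E; rewrite !qevalE (wRF (wc_axioms E)).
- by move=> n w; apply: qeval_inj => E; rewrite !qevalE (wFlam (wc_axioms E)).
- by move=> n q x; apply: qeval_inj => E; rewrite !qevalE (wRV (wc_axioms E)).
- by move=> n p q r h x y; apply: qeval_inj => E; rewrite !qevalE (wVF (wc_axioms E)).
- by move=> n w; apply: qeval_inj => E; rewrite !qevalE (wVlam (wc_axioms E)).
- move=> n q x; apply: qeval_inj => E.
  by rewrite raddfMn /= !qevalE (wFV (wc_axioms E)).
- by move=> n q x; apply: qeval_inj => E; rewrite !qevalE (wRd (wc_axioms E)).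
- move=> n p q r h hl hr x y; apply: qeval_inj => E.
  by rewrite raddfD raddfMz /= !qevalE; apply: (wdM (wc_axioms E)).
- move=> n q x; apply: qeval_inj => E.
  by rewrite [RHS]qeval_add qeval_iota !qevalE (wFdV (wc_axioms E)).
- move=> n q x; apply: qeval_inj => E.
  by rewrite !qeval_d qeval_iota (wdd (wc_axioms E)).
- move=> n q x; apply: qeval_inj => E.
  by rewrite qeval_iota !qeval_d qeval_iota (wd_iota (wc_axioms E)).
- by move=> n a; apply: qeval_inj => E; rewrite !qevalE (wFd_teich (wc_axioms E)).
Qed.

(** * The log structure *)

Definition tpreLog (n : nat) : preLog M (deg0 (tring n)).
Proof.
(* Once the map from [M] is the identity, [lw_lam_alpha] forces this formula. *)
exists (fun a => tlam n (witt_preLog alpha n a)) => [|a b]; last by rewrite pl_mul rmorphM.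
by rewrite pl_one rmorph1.
Defined.

Definition tpreLogWitt : preLogWitt A M :=
  @PreLogWitt A M (WittComplex tpreWitt_axioms) M tpreLog qdlog (@idfun M).

Lemma tlogWitt_axioms : isLogWitt alpha tpreLogWitt.
Proof.
split=> /=.
- move=> n; apply: qeval_inj => E.
  by rewrite raddf0 /= !qevalE gmulf1 (lw_dlog1 (lw_axioms E)).
- move=> n a b; apply: qeval_inj => E.
  by rewrite raddfD /= !qevalE gmulfM (lw_dlogM (lw_axioms E)).
- by move=> n a; apply: qeval_inj => E; rewrite !qevalE (lw_Rdlog (lw_axioms E)).
- move=> n a; apply: qeval_inj => E.
  (* In [E], [lambda] of the Teichmüller lift of [alpha a] is [lw_alpha] of the image of [a], so the
     derivation law of [E] applies. *)
  by rewrite !qevalE -(lw_lam_alpha (lw_axioms E)) (lw_dlog_der (lw_axioms E)).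
- by [].
- move=> n a; apply: qeval_inj => E.
  by rewrite !qevalE -!(lw_lam_alpha (lw_axioms E)) (lw_Ralpha (lw_axioms E)).
- move=> n a; apply: qeval_inj => E.
  by rewrite raddf0 /= !qevalE (lw_d_dlog (lw_axioms E)).
- by move=> n a; apply: qeval_inj => E; rewrite !qevalE (lw_Fdlog (lw_axioms E)).
Qed.

Definition tlogWitt : logWitt alpha := LogWitt tlogWitt_axioms.

(** * Initiality *)

Definition qeval_gmor (E : logWitt alpha) n : gmor (tlogWitt n) (E n).
Proof.
exists (fun q => @qeval E n q : {additive tquot n q -> E n q}).
  exact: qeval_one.
exact: qeval_mul.
Defined.

Definition qeval_wittMor (E : logWitt alpha) : wittMor tlogWitt E.
Proof.
exists (qeval_gmor E).
- exact: qeval_R.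
- exact: qeval_lam.
- exact: qeval_d.
- exact: qeval_F.
- exact: qeval_V.
Defined.

Definition qeval_logWittMor (E : logWitt alpha) : logWittMor tlogWitt E.
Proof.
exists (qeval_wittMor E) (lw_lam E) => [//|n a|n a].
  by rewrite (lw_lam_alpha (lw_axioms E)); apply: qeval_lam.
exact: qeval_dlog.
Defined.

(** Each class is obtained by operations that a morphism preserves from [lambda], [dlog] on [M] and
    the constants 0 and 1, so induction on the term leaves no freedom. *)
Lemma logWittMor_tpi (E : logWitt alpha) (g : logWittMor tlogWitt E) n q
    (t : term n q) :
  g n q (tpi t) = eval E t.
Proof.
elim: t => /= {n q} [n q|n q t IHt|n q t IHt u IHu|n|n p q r h t IHt u IHu
  |n q t IHt|n w|n q t IHt|n q t IHt|n q t IHt|n a].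
- exact: (raddf0 (g n q)).
(* The right-hand side is formed from the representative chosen for the class of [t], not from [t],
   so the equality is checked on values. The other compound terms are treated alike. *)
- have -> : tpi (TOpp t) = - tpi t.
    by apply: qeval_inj => F; rewrite raddfN /= !qeval_pi.
  by rewrite -IHt; apply: (raddfN (g n q)).
- have -> : tpi (TAdd t u) = tpi t + tpi u.
    by apply: qeval_inj => F; rewrite raddfD /= !qeval_pi.
  by rewrite -IHt -IHu; apply: (raddfD (g n q)).
- exact: (gm_one (g n)).
- have -> : tpi (TMul h t u) = qmul h (tpi t) (tpi u).
    by apply: qeval_inj => F; rewrite qeval_mul !qeval_pi.
  by rewrite -IHt -IHu; apply: (gm_mul (g n)).
- have -> : tpi (TR t) = qR (tpi t).
    by apply: qeval_inj => F; rewrite qeval_R !qeval_pi.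
  by rewrite -IHt; apply: (wm_R g).
- exact: (wm_lam g).
- have -> : tpi (TF t) = qF (tpi t).
    by apply: qeval_inj => F; rewrite qeval_F !qeval_pi.
  by rewrite -IHt; apply: (wm_F g).
- have -> : tpi (TV t) = qV (tpi t).
    by apply: qeval_inj => F; rewrite qeval_V !qeval_pi.
  by rewrite -IHt; apply: (wm_V g).
- have -> : tpi (TD t) = qd (tpi t).
    by apply: qeval_inj => F; rewrite qeval_d !qeval_pi.
  by rewrite -IHt; apply: (wm_d g).
(* The map from [M] into the term model is the identity, so [lm_lam] makes the monoid map of [g]
   equal to [lw_lam E]. *)
- by rewrite -(lm_lam g); apply: (lm_dlog g).
Qed.

Lemma tlogWitt_initial : isInitial tlogWitt.
Proof.
move=> E; exists (qeval_logWittMor E) => g.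
split=> [n q x|a]; last exact: (lm_lam g).
by rewrite -[x in LHS]tpiK; apply: logWittMor_tpi.
Qed.

End TermModel.

Theorem proposition4p9 (A : comPzRingType) (M : monoidType) (alpha : preLog M A) :
  exists E : logWitt alpha, isInitial E.
Proof. by exists (tlogWitt alpha); apply: tlogWitt_initial. Qed.
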